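(* Let $k$ be a field, and let $\alpha = (\{X_g\}_{g\in G}, \{\alpha_g\}_{g\in G})$ be a partial action of a finite group $G$ on a finite set $X$. Let $\theta$ be the partial action of $G$ on the algebra of functions $\mathrm{Fun}(X,k)$ induced by $\alpha$. Then the groupoid algebra $k\mathcal{G}(G,X,\alpha)$ of the partial action groupoid is isomorphic, as a $k$-algebra, to the partial skew group algebra $\mathrm{Fun}(X,k)\rtimes_{\theta} G$.
   Context: **Partial action on a set.** A partial action $\alpha = (\{X_g\}_{g\in G}, \{\alpha_g\}_{g\in G})$ of a group $G$ (with neutral element $e$) on a set $X$ consists of subsets $X_g\subseteq X$ and bijections $\alpha_g: X_{g^{-1}}\to X_g$, one for each $g\in G$, such that (i) $X_e = X$ and $\alpha_e = \mathrm{Id}_X$; (ii) $(\alpha_h)^{-1}(X_{g^{-1}}\cap X_h)\subseteq X_{(gh)^{-1}}$ for all $g,h\in G$; (iii) $\alpha_g(\alpha_h(x)) = \alpha_{gh}(x)$ for all $g,h\in G$ and $x\in(\alpha_h)^{-1}(X_{g^{-1}}\cap X_h)$. **Induced partial action on functions.** $A=\mathrm{Fun}(X,k)$ is the $k$-algebra of functions $X\to k$ with pointwise operations. For $g\in G$, $A_g$ is the ideal of functions vanishing outside $X_g$, and $\theta_g: A_{g^{-1}}\to A_g$ is the algebra isomorphism given by $(\theta_g(f))(x) = f(\alpha_{g^{-1}}(x))$ for $f\in A_{g^{-1}}$ and $x\in X_g$ (and $(\theta_g(f))(x)=0$ for $x\notin X_g$). **Partial skew group algebra.** $A\rtimes_\theta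 G = \bigoplus_{g\in G} A_g\delta_g$ as a $k$-vector space (the $\delta_g$ being formal symbols), with multiplication determined by $(a\delta_g)(b\delta_h) = \theta_g(\theta_{g^{-1}}(a)\,b)\,\delta_{gh}$ for $a\in A_g$, $b\in A_h$; its unit is $1_A\delta_e$. **Partial action groupoid and its algebra.** $\mathcal{G}(G,X,\alpha) = \{(x,g)\in X\times G \mid x\in X_g\}$. The groupoid algebra $k\mathcal{G}(G,X,\alpha)$ is the $k$-vector space with basis $\{\delta_{(x,g)} \mid (x,g)\in\mathcal{G}(G,X,\alpha)\}$, with multiplication $\delta_{(x,g)}\,\delta_{(y,h)} = \delta_{(x,gh)}$ if $\alpha_{g^{-1}}(x)=y$ and $\delta_{(x,g)}\,\delta_{(y,h)}=0$ otherwise, and with unit $\sum_{x\in X}\delta_{(x,e)}$. *)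

(* Defs.v *)
From HB Require Import structures.
From mathcomp Require Import all_boot all_order all_fingroup all_algebra.

Set Implicit Arguments.
Unset Strict Implicit.
Unset Printing Implicit Defensive.

Import GRing.Theory.
Local Open Scope ring_scope.

(* pact g is a total function of which only the restriction to pdom g^-1
   matters; pact_inj and pact_im say that this restriction is a bijection onto
   pdom g.  In pact_dom and pactM, the inverse image under this restriction is
   the intersection of pdom h^-1 with the inverse image under pact h. *)
Record partial_action (gT : finGroupType) (X : finType) := PartialAction {
  pdom : gT -> {set X};
  pact : gT -> X -> X;
  pact_inj : forall g : gT, {in pdom g^-1%g &, injective (pact g)};
  pact_im : forall g : gT, pact g @: pdom g^-1%g = pdom g;
  pdom1 : pdom 1%g = [set: X];
  pact1 : forall x : X, pact 1%g x = x;
  pact_dom : forall g h : gT,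
    pdom h^-1%g :&: pact h @^-1: (pdom g^-1%g :&: pdom h)
      \subset pdom (g * h)^-1%g;
  pactM : forall (g h : gT) (x : X),
    x \in pdom h^-1%g :&: pact h @^-1: (pdom g^-1%g :&: pdom h) ->
    pact g (pact h x) = pact (g * h)%g x
}.

Section PartialActionTheory.
Variables (gT : finGroupType) (X : finType) (alpha : partial_action gT X).
Local Notation D := (pdom alpha).
Local Notation act := (pact alpha).

Lemma pact_mem (g : gT) x : x \in D g^-1%g -> act g x \in D g.
Proof. by move=> Dx; rewrite -[D g](pact_im alpha) imset_f. Qed.

Lemma pactV_mem (g : gT) x : x \in D g -> act g^-1%g x \in D g^-1%g.
Proof. by move=> Dx; apply: pact_mem; rewrite invgK. Qed.

Lemma pact_comp (g h : gT) x : x \in D g -> act g^-1%g x \in D h ->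
  (x \in D (g * h)%g) * (act h^-1%g (act g^-1%g x) = act (g * h)^-1%g x).
Proof.
move=> Dgx Dhx.
have Ex : x \in D g^-1^-1%g :&: act g^-1%g @^-1: (D h^-1^-1%g :&: D g^-1%g).
  by rewrite !inE !invgK Dgx Dhx pactV_mem.
split; last by rewrite pactM // invMg.
have := subsetP (pact_dom alpha h^-1%g g^-1%g) x Ex.
by rewrite -invMg invgK.
Qed.

Lemma pactK (g : gT) x : x \in D g -> act g (act g^-1%g x) = x.
Proof.
move=> Dx; have := pact_comp Dx (pactV_mem Dx).
by rewrite invgK mulgV invg1 pact1 => -[].
Qed.

Lemma pdom_divr (g l : gT) x :
  x \in D g -> act g^-1%g x \in D (g^-1 * l)%g -> x \in D l.
Proof. by move=> Dx Dy; have [] := pact_comp Dx Dy; rewrite mulKVg. Qed.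

Section Convolution.
Variable k : pzRingType.
Implicit Types u v w : gT -> X -> k.

Definition supported u := forall g x, x \notin D g -> u g x = 0.

Definition conv u v l x := \sum_g u g x * v (g^-1 * l)%g (act g^-1%g x).

Lemma convA u v w : supported u -> supported v ->
  forall l x, conv (conv u v) w l x = conv u (conv v w) l x.
Proof.
move=> su sv l x; rewrite /conv.
under eq_bigr do rewrite mulr_suml.
under [RHS]eq_bigr do rewrite mulr_sumr.
rewrite exchange_big; apply: eq_bigr => g _ /=.
rewrite (reindex_inj (mulgI g)); apply: eq_bigr => h _ /=.
rewrite mulKg mulrA invMg -mulgA.
have [Dx|/su->] := boolP (x \in D g); last by rewrite !mul0r.
have [Dy|/sv->] := boolP (act g^-1%g x \in D h); last by rewrite mulr0 !mul0r.
by have [_ ->] := pact_comp Dx Dy; rewrite invMg.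
Qed.

Lemma conv1l v l x : conv (fun g _ => (g == 1%g)%:R) v l x = v l x.
Proof.
rewrite /conv (bigD1 1%g) //= eqxx mul1r invg1 mul1g pact1 big1 ?addr0 // => g.
by move/negPf->; rewrite mul0r.
Qed.

Lemma conv1r u l x : conv u (fun g _ => (g == 1%g)%:R) l x = u l x.
Proof.
rewrite /conv (bigD1 l) //= mulVg eqxx mulr1 big1 ?addr0 // => g ngl.
by rewrite -eq_mulVg1 (negPf ngl) mulr0.
Qed.

End Convolution.
End PartialActionTheory.

Section PartialSkewGroupAlgebra.
Variables (k : fieldType) (gT : finGroupType) (X : finType).
Variable alpha : partial_action gT X.
Local Notation D := (pdom alpha).
Local Notation act := (pact alpha).

(* k^o is k as a module over itself; the ring structure of the library on
   {ffun X -> k^o} is the pointwise one. *)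
Local Notation FunXk := {ffun X -> k^o}.
Implicit Types (g h l : gT) (x : X) (a b : FunXk).

Definition fun_ideal g : pred FunXk :=
  [pred a : FunXk | [forall x, (x \notin D g) ==> (a x == 0)]].

Lemma fun_idealP g a :
  reflect (forall x, x \notin D g -> a x = 0) (a \in fun_ideal g).
Proof.
apply: (iffP forallP) => Ha x; first by move/(implyP (Ha x))/eqP.
by apply/implyP=> /Ha->.
Qed.

(* Defined on all of Fun(X,k), but only used on A_(g^-1). *)
Definition theta g a : FunXk :=
  [ffun x => if x \in D g then a (act g^-1%g x) else 0].

Lemma theta_ideal g a : theta g a \in fun_ideal g.
Proof. by apply/fun_idealP=> x /negPf nDx; rewrite ffunE nDx. Qed.

Lemma thetaK g a : a \in fun_ideal g -> theta g (theta g^-1%g a) = a.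
Proof.
move/fun_idealP=> Aa; apply/ffunP=> x; rewrite !ffunE.
case: ifPn => [Dx | /Aa-> //].
by rewrite pactV_mem // invgK pactK.
Qed.

(* As gT is finite, the direct sum of the A_g is the space of all families
   (a_g)_g with a_g in A_g. *)
Definition skew_pred : pred {ffun gT -> FunXk} :=
  [pred u : {ffun gT -> FunXk} | [forall g, u g \in fun_ideal g]].

Lemma skew_predP (u : {ffun gT -> FunXk}) :
  reflect (forall g, u g \in fun_ideal g) (u \in skew_pred).
Proof. exact: forallP. Qed.

Fact skew_submod_closed : submod_closed skew_pred.
Proof.
split=> [|c u v /skew_predP Pu /skew_predP Pv].
  by apply/skew_predP=> g; apply/fun_idealP=> x _; rewrite !ffunE.
apply/skew_predP=> g; apply/fun_idealP=> x nDx; rewrite !ffunE.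
by rewrite (fun_idealP _ _ (Pu g)) // (fun_idealP _ _ (Pv g)) // scaler0 addr0.
Qed.
HB.instance Definition _ :=
  GRing.isSubmodClosed.Build k {ffun gT -> FunXk} skew_pred skew_submod_closed.

Record partial_skew_alg := PartialSkewAlg {
  skew_val :> {ffun gT -> FunXk};
  skew_valP : skew_val \in skew_pred
}.

HB.instance Definition _ := [isSub for skew_val].
HB.instance Definition _ := [Choice of partial_skew_alg by <:].
HB.instance Definition _ := [SubChoice_isSubLmodule of partial_skew_alg by <:].

Implicit Types u v w : partial_skew_alg.

(* The family a delta_g. *)
Definition skew_term a g : {ffun gT -> FunXk} :=
  [ffun l => if l == g then a else 0].

Lemma skew_coef_ideal u g : u g \in fun_ideal g.
Proof. exact: (skew_predP _ (skew_valP u)). Qed.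

Lemma skew_coef0 u g x : x \notin D g -> u g x = 0.
Proof. exact: (fun_idealP _ _ (skew_coef_ideal u g)). Qed.

Lemma skew_term_in a g : a \in fun_ideal g -> skew_term a g \in skew_pred.
Proof.
move=> Aa; apply/skew_predP=> l; rewrite ffunE.
by case: eqP => [-> // | _]; apply/fun_idealP=> x _; rewrite ffunE.
Qed.

Lemma theta_mul_ideal g h a b : b \in fun_ideal h ->
  theta g (theta g^-1%g a * b) \in fun_ideal (g * h)%g.
Proof.
move=> /fun_idealP Ab; apply/fun_idealP=> x nDx; rewrite !ffunE.
case: ifPn => // Dx; rewrite [b _]Ab ?mulr0 //.
by apply: contraNN nDx => Dy; have [] := pact_comp Dx Dy.
Qed.

Definition skew_mul_family u v : {ffun gT -> FunXk} :=
  \sum_g \sum_h skew_term (theta g (theta g^-1%g (u g) * v h)) (g * h)%g.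

Fact skew_mul_subproof u v : skew_mul_family u v \in skew_pred.
Proof.
apply: rpred_sum => g _; apply: rpred_sum => h _.
exact/skew_term_in/theta_mul_ideal/skew_coef_ideal.
Qed.

Definition skew_mul u v : partial_skew_alg :=
  PartialSkewAlg (skew_mul_subproof u v).

Fact skew_one_subproof : skew_term 1 1%g \in skew_pred.
Proof. by apply/skew_term_in/fun_idealP=> x; rewrite pdom1 inE. Qed.

Definition skew_one : partial_skew_alg := PartialSkewAlg skew_one_subproof.

Lemma skew_ext u v : (forall g x, u g x = v g x) -> u = v.
Proof. by move=> E; apply/val_inj/ffunP=> g; apply/ffunP=> x; apply: E. Qed.

Lemma skew_mulE u v l x :
  skew_mul u v l x = conv alpha (fun g y => u g y) (fun g y => v g y) l x.
Proof.
rewrite /= /skew_mul_family /conv !sum_ffunE; apply: eq_bigr => g _.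
rewrite !sum_ffunE (bigD1 (g^-1 * l)%g) //= big1 ?addr0 => [|h nh].
  rewrite !ffunE mulKVg eqxx !ffunE.
  case: ifPn => [Dx | /skew_coef0-> ]; last by rewrite mul0r.
  by rewrite pactV_mem // invgK pactK.
by rewrite !ffunE ifN ?ffunE // eq_sym -(inj_eq (mulgI g^-1%g)) mulKg.
Qed.

Lemma skew_oneE g x : skew_one g x = (g == 1%g)%:R.
Proof. by rewrite /= ffunE; case: eqP => _; rewrite ffunE. Qed.

Fact skew_mulA : associative skew_mul.
Proof.
move=> u v w; apply: skew_ext => l x; rewrite !skew_mulE.
transitivity (conv alpha (fun g y => u g y)
  (conv alpha (fun g y => v g y) (fun g y => w g y)) l x).
  by apply: eq_bigr => g _; rewrite skew_mulE.
rewrite -convA; try by move=> g y; apply: skew_coef0.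
by apply: eq_bigr => g _; rewrite skew_mulE.
Qed.

Fact skew_mul1l : left_id skew_one skew_mul.
Proof.
move=> u; apply: skew_ext => l x; rewrite skew_mulE.
rewrite -[RHS](conv1l alpha (fun g y => u g y)).
by apply: eq_bigr => g _; rewrite skew_oneE.
Qed.

Fact skew_mul1r : right_id skew_one skew_mul.
Proof.
move=> u; apply: skew_ext => l x; rewrite skew_mulE.
rewrite -[RHS](conv1r alpha (fun g y => u g y)).
by apply: eq_bigr => g _; rewrite skew_oneE.
Qed.

Lemma skew_addE u v g x : (u + v) g x = u g x + v g x.
Proof.
have -> : skew_val (u + v) = skew_val u + skew_val v by exact: (raddfD val).
by rewrite !ffunE.
Qed.

Lemma skew_scaleE (c : k) u g x : (c *: u) g x = c * u g x.
Proof.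
have -> : skew_val (c *: u) = c *: skew_val u by exact: (linearZ_LR val).
by rewrite !ffunE.
Qed.

Fact skew_mulDl : left_distributive skew_mul +%R.
Proof.
move=> u v w; apply: skew_ext => l x.
rewrite skew_addE !skew_mulE -big_split; apply: eq_bigr => g _ /=.
by rewrite skew_addE mulrDl.
Qed.

Fact skew_mulDr : right_distributive skew_mul +%R.
Proof.
move=> u v w; apply: skew_ext => l x.
rewrite skew_addE !skew_mulE -big_split; apply: eq_bigr => g _ /=.
by rewrite skew_addE mulrDr.
Qed.

(* When X = set0 this ring is trivial, so that it cannot be an algType, which
   requires 1 != 0; skew_scalerAl and skew_scalerAr below provide the remaining
   axioms of a k-algebra. *)
HB.instance Definition _ := GRing.Zmodule_isPzRing.Build partial_skew_alg
  skew_mulA skew_mul1l skew_mul1r skew_mulDl skew_mulDr.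

Lemma skew_scalerAl (c : k) u v : c *: (u * v) = (c *: u) * v.
Proof.
apply: skew_ext => l x; rewrite skew_scaleE !skew_mulE mulr_sumr.
by apply: eq_bigr => g _; rewrite skew_scaleE mulrA.
Qed.

Lemma skew_scalerAr (c : k) u v : c *: (u * v) = u * (c *: v).
Proof.
apply: skew_ext => l x; rewrite skew_scaleE !skew_mulE mulr_sumr.
by apply: eq_bigr => g _; rewrite skew_scaleE mulrCA.
Qed.

Definition skew_delta a g (Aa : a \in fun_ideal g) : partial_skew_alg :=
  PartialSkewAlg (skew_term_in Aa).

Lemma skew_deltaM a b g h (Aa : a \in fun_ideal g) (Ab : b \in fun_ideal h) :
  skew_delta Aa * skew_delta Ab = skew_delta (theta_mul_ideal g a Ab).
Proof.
have theta0 l : theta l 0 = 0.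
  by apply/ffunP=> x; rewrite !ffunE; case: ifP => //; rewrite ffunE.
have term0 l : skew_term 0 l = 0 by apply/ffunP=> m; rewrite !ffunE; case: ifP.
apply: val_inj => /=; rewrite /skew_mul_family (bigD1 g) //= (bigD1 h) //=.
rewrite !ffunE !eqxx big1 => [|l /negPf nl]; last first.
  by rewrite ffunE nl mulr0 theta0 term0.
rewrite addr0 big1 ?addr0 // => l /negPf nl; apply: big1 => m _.
by rewrite ffunE nl theta0 mul0r theta0 term0.
Qed.

End PartialSkewGroupAlgebra.

Section GroupoidAlgebra.
Variables (k : fieldType) (gT : finGroupType) (X : finType).
Variable alpha : partial_action gT X.
Local Notation D := (pdom alpha).
Local Notation act := (pact alpha).

Definition pa_groupoid := {p : X * gT | p.1 \in D p.2}.
HB.instance Definition _ := Finite.on pa_groupoid.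

(* Only the vector space structure is inherited from the finite functions:
   the library's ring structure on them is pointwise. *)
Definition groupoid_alg := {ffun pa_groupoid -> k^o}.
HB.instance Definition _ := GRing.Lmodule.on groupoid_alg.

Implicit Types (u v w : groupoid_alg) (p q r : pa_groupoid).

(* The basis vector delta_s if s is in the groupoid, and 0 otherwise. *)
Definition gdelta (s : X * gT) : groupoid_alg :=
  [ffun r : pa_groupoid => (val r == s)%:R].

Definition gdelta_mul (s t : X * gT) : groupoid_alg :=
  if act s.2^-1%g s.1 == t.1 then gdelta (s.1, (s.2 * t.2)%g) else 0.

Lemma groupoid_comp_mem p q : act (val p).2^-1%g (val p).1 = (val q).1 ->
  (val p).1 \in D ((val p).2 * (val q).2)%g.
Proof.
by move=> E; have [] := pact_comp (valP p) (etrans (congr1 _ E) (valP q)).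
Qed.

Definition groupoid_mul u v : groupoid_alg :=
  \sum_p \sum_q (u p * v q) *: gdelta_mul (val p) (val q).

Definition groupoid_one : groupoid_alg := \sum_(x : X) gdelta (x, 1%g).

(* Coefficients, extended by 0 outside the groupoid. *)
Definition gcoef u (g : gT) (x : X) : k := oapp u 0 (insub (x, g)).

Lemma gcoefE u r : gcoef u (val r).2 (val r).1 = u r.
Proof. by rewrite /gcoef -surjective_pairing valK. Qed.

Lemma gcoef_supported u : supported alpha (gcoef u).
Proof. by move=> g x nDx; rewrite /gcoef insubN. Qed.

Lemma sum_gcoef u (F : X -> gT -> k) :
  \sum_p u p * F (val p).1 (val p).2 = \sum_x \sum_g gcoef u g x * F x g.
Proof.
rewrite pair_big /= (bigID (fun s : X * gT => s.1 \in D s.2)) /=.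
rewrite [X in _ + X]big1 ?addr0 => [|s ns]; last first.
  by rewrite gcoef_supported // mul0r.
rewrite (reindex_omap (val : pa_groupoid -> _) insub) /= => [|s Ds].
  apply: eq_big => [p|p _]; first by rewrite valK eqxx (valP p).
  by rewrite gcoefE.
by rewrite insubT.
Qed.

Lemma gdelta_mulE (s t : X * gT) r : gdelta_mul s t r =
  ((act s.2^-1%g s.1 == t.1) && (val r == (s.1, (s.2 * t.2)%g)))%:R.
Proof. by rewrite /gdelta_mul; case: eqP; rewrite ffunE. Qed.

Lemma groupoid_mulE u v r : groupoid_mul u v r =
  conv alpha (gcoef u) (gcoef v) (val r).2 (val r).1.
Proof.
case Er: (val r) => [x l] /=.
pose F y g z h : k :=
  ((act g^-1%g y == z) && ((x, l) == (y, (g * h)%g)))%:R.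
transitivity (\sum_y \sum_g gcoef u g y * \sum_z \sum_h gcoef v h z * F y g z h).
  under eq_bigr do under eq_bigr do rewrite -sum_gcoef.
  rewrite -(sum_gcoef u (fun y g => \sum_q v q * F y g (val q).1 (val q).2)).
  rewrite sum_ffunE; apply: eq_bigr => p _.
  rewrite sum_ffunE mulr_sumr; apply: eq_bigr => q _.
  by rewrite ffunE gdelta_mulE Er mulrA.
rewrite (bigD1 x) //= [X in _ + X]big1 ?addr0 => [|y nyx]; last first.
  apply: big1 => g _; rewrite big1 ?mulr0 // => z _; apply: big1 => h _.
  by rewrite /F xpair_eqE [x == y]eq_sym (negPf nyx) andbF mulr0.
apply: eq_bigr => g _; congr (_ * _).
rewrite (bigD1 (act g^-1%g x)) //= [X in _ + X]big1 ?addr0 => [|z nz]; last first.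
  by apply: big1 => h _; rewrite /F [_ == z]eq_sym (negPf nz) mulr0.
rewrite (bigD1 (g^-1 * l)%g) //= big1 ?addr0 => [|h nh].
  by rewrite /F mulKVg !eqxx mulr1.
rewrite /F xpair_eqE -(inj_eq (mulgI g^-1%g) l) mulKg.
by rewrite [_ == h]eq_sym (negPf nh) !andbF mulr0.
Qed.

Lemma gcoef_mul u v (g : gT) x :
  gcoef (groupoid_mul u v) g x = conv alpha (gcoef u) (gcoef v) g x.
Proof.
have [Dx|nDx] := boolP (x \in D g).
  by rewrite -[LHS]/(gcoef _ (x, g).2 (x, g).1) /gcoef insubT /= groupoid_mulE.
rewrite gcoef_supported //; apply/esym/big1 => h _.
have [Dh|/gcoef_supported->] := boolP (x \in D h); last by rewrite mul0r.
rewrite [gcoef v _ _]gcoef_supported ?mulr0 //.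
by apply: contraNN nDx => /(pdom_divr Dh).
Qed.

Lemma groupoid_oneE r : groupoid_one r = ((val r).2 == 1%g)%:R.
Proof.
rewrite sum_ffunE (bigD1 (val r).1) //= big1 ?addr0 => [|x nx].
  by rewrite ffunE [val r]surjective_pairing xpair_eqE eqxx.
by rewrite ffunE [val r]surjective_pairing xpair_eqE eq_sym (negPf nx).
Qed.

Lemma gcoef_one (g : gT) x : gcoef groupoid_one g x = (g == 1%g)%:R.
Proof.
have [Dx|nDx] := boolP (x \in D g).
  by rewrite /gcoef insubT /= groupoid_oneE.
rewrite gcoef_supported //; case: eqP nDx => // ->.
by rewrite pdom1 inE.
Qed.

Fact groupoid_mulA : associative groupoid_mul.
Proof.
move=> u v w; apply/ffunP=> r; rewrite !groupoid_mulE.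
transitivity (conv alpha (gcoef u) (conv alpha (gcoef v) (gcoef w))
    (val r).2 (val r).1).
  by apply: eq_bigr => g _; rewrite gcoef_mul.
rewrite -convA; try exact: gcoef_supported.
by apply: eq_bigr => g _; rewrite gcoef_mul.
Qed.

Fact groupoid_mul1l : left_id groupoid_one groupoid_mul.
Proof.
move=> u; apply/ffunP=> r; rewrite groupoid_mulE -[RHS]gcoefE.
by rewrite -[RHS](conv1l alpha); apply: eq_bigr => g _; rewrite gcoef_one.
Qed.

Fact groupoid_mul1r : right_id groupoid_one groupoid_mul.
Proof.
move=> u; apply/ffunP=> r; rewrite groupoid_mulE -[RHS]gcoefE.
by rewrite -[RHS](conv1r alpha); apply: eq_bigr => g _; rewrite gcoef_one.
Qed.

Fact groupoid_mulDl : left_distributive groupoid_mul +%R.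
Proof.
move=> u v w; rewrite -big_split; apply: eq_bigr => p _ /=.
rewrite -big_split; apply: eq_bigr => q _ /=.
by rewrite -scalerDl -mulrDl ffunE.
Qed.

Fact groupoid_mulDr : right_distributive groupoid_mul +%R.
Proof.
move=> u v w; rewrite -big_split; apply: eq_bigr => p _ /=.
rewrite -big_split; apply: eq_bigr => q _ /=.
by rewrite -scalerDl -mulrDr ffunE.
Qed.

HB.instance Definition _ := GRing.Zmodule_isPzRing.Build groupoid_alg
  groupoid_mulA groupoid_mul1l groupoid_mul1r groupoid_mulDl groupoid_mulDr.

Lemma groupoid_scalerAl (c : k) u v : c *: (u * v) = (c *: u) * v.
Proof.
rewrite [LHS]scaler_sumr; apply: eq_bigr => p _.
rewrite scaler_sumr; apply: eq_bigr => q _.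
by rewrite scalerA mulrA ffunE.
Qed.

Lemma groupoid_scalerAr (c : k) u v : c *: (u * v) = u * (c *: v).
Proof.
rewrite [LHS]scaler_sumr; apply: eq_bigr => p _.
rewrite scaler_sumr; apply: eq_bigr => q _.
by rewrite scalerA mulrCA ffunE.
Qed.

Lemma gdeltaM p q : gdelta (val p) * gdelta (val q) =
  if act (val p).2^-1%g (val p).1 == (val q).1
  then gdelta ((val p).1, ((val p).2 * (val q).2)%g) else 0.
Proof.
rewrite -[RHS]/(gdelta_mul (val p) (val q)).
rewrite -[LHS]/(groupoid_mul _ _) /groupoid_mul (bigD1 p) //= (bigD1 q) //=.
rewrite !ffunE !eqxx mulr1 scale1r big1 => [|r /negPf nr]; last first.
  by rewrite ffunE (inj_eq val_inj) nr mulr0 scale0r.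
rewrite addr0 big1 ?addr0 // => r /negPf nr; apply: big1 => s _.
by rewrite ffunE (inj_eq val_inj) nr mul0r scale0r.
Qed.

End GroupoidAlgebra.

(* Main.v *)
Require Import Defs.
From mathcomp Require Import all_boot all_order all_fingroup all_algebra.
Local Open Scope ring_scope.

(** In both algebras an element is determined by its coefficients on X x G
    extended by 0 outside the groupoid, and both products become the same
    convolution of coefficients; the isomorphism
    delta_(x,g) |-> 1_{x} delta_g preserves these coefficients. *)

Section CoefficientMaps.
Variables (k : fieldType) (gT : finGroupType) (X : finType).
Variable alpha : partial_action gT X.
Implicit Types (u v : groupoid_alg k alpha) (w : partial_skew_alg k alpha).

(** Extending by 0 outside the groupoid is what puts the component at [g] into the ideal A_g. *)
Lemma gcoef_family_skew u :
  [ffun g => [ffun x => gcoef u g x : k^o]] \in skew_pred alpha.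
Proof.
by apply/skew_predP=> g; apply/fun_idealP=> x nDx; rewrite !ffunE gcoef_supported.
Qed.

Definition skew_of_groupoid u : partial_skew_alg k alpha :=
  PartialSkewAlg (gcoef_family_skew u).

Definition groupoid_of_skew w : groupoid_alg k alpha :=
  [ffun r => w (val r).2 (val r).1].

Lemma skew_of_groupoidE u g x : skew_of_groupoid u g x = gcoef u g x.
Proof. by rewrite /= !ffunE. Qed.

Lemma skew_of_groupoid_inE u r :
  skew_of_groupoid u (val r).2 (val r).1 = u r.
Proof. by rewrite skew_of_groupoidE gcoefE. Qed.

Lemma skew_of_groupoidK : cancel skew_of_groupoid groupoid_of_skew.
Proof. by move=> u; apply/ffunP=> r; rewrite ffunE skew_of_groupoid_inE. Qed.

(** The component at [g] vanishes off [pdom alpha g], so no information lies outside the groupoid.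
    Equalities can thus be checked where the coefficients of [skew_of_groupoid u] are the values of
    [u]. *)
Lemma skew_eq w w' : (forall r : pa_groupoid alpha,
  w (val r).2 (val r).1 = w' (val r).2 (val r).1) -> w = w'.
Proof.
move=> E; apply: skew_ext => g x.
have [Dx|nDx] := boolP (x \in pdom alpha g); first exact: (E (exist _ (x, g) Dx)).
by rewrite !skew_coef0.
Qed.

Lemma groupoid_of_skewK : cancel groupoid_of_skew skew_of_groupoid.
Proof. by move=> w; apply: skew_eq => r; rewrite skew_of_groupoid_inE ffunE. Qed.

Lemma skew_of_groupoid_linear : linear skew_of_groupoid.
Proof.
move=> c u v; apply: skew_eq => r.
by rewrite skew_addE skew_scaleE !skew_of_groupoid_inE !ffunE.
Qed.

Lemma skew_of_groupoid_monoid : GRing.monoid_morphism skew_of_groupoid.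
Proof.
(* The formulas for units and products hold at every pair in X x G, so no restriction to the
   groupoid is made here. *)
split=> [|u v]; apply: skew_ext => g x; rewrite skew_of_groupoidE.
  by rewrite [LHS]gcoef_one [RHS]skew_oneE.
rewrite [LHS]gcoef_mul [RHS]skew_mulE.
by apply: eq_bigr => h _; rewrite !skew_of_groupoidE.
Qed.

End CoefficientMaps.

Theorem theorem2p6 (k : fieldType) (gT : finGroupType) (X : finType)
    (alpha : partial_action gT X) :
  exists f : groupoid_alg k alpha -> partial_skew_alg k alpha,
    [/\ linear f, GRing.monoid_morphism f & bijective f].
Proof.
exists (skew_of_groupoid k gT X alpha); split.
- exact: skew_of_groupoid_linear.
- exact: skew_of_groupoid_monoid.
by exists (groupoid_of_skew k gT X alpha);
  [apply: skew_of_groupoidK | apply: groupoid_of_skewK].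
Qed.
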